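(* Let $P$ be a simplifiable SUSP. Then $P$ generates an infinite family of simplifiable SUSPs; that is, for every integer $m\ge 1$ the power $P^m$ is a simplifiable SUSP.
   Context: Puzzles. For $s,k\in\mathbb{N}$, an $(s,k)$-puzzle is a subset $P\subseteq\{1,2,3\}^k$ with $|P|=s$. The product of puzzles is $P_1\times P_2=\{r_1\circ r_2 : r_1\in P_1,\ r_2\in P_2\}$, where $\circ$ is concatenation, and $P^m$ is the product of $P$ with itself $m$ times, an $(s^m,km)$-puzzle. The family generated by $P$ is $\mathcal{F}_P=\{P^m : m\in\mathbb{N}\}$. 3D graphs. A 3D graph $H$ with finite domain $U$ is given by an edge set $E(H)\subseteq U^3$ (a 3-uniform hypergraph on three disjoint copies of $U$). Its projections are the 2D graphs $R_0,R_1,R_2$ on $U$ with edge sets $E(R_0)=\{(v,w): \exists u,\ (u,v,w)\in E(H)\}$, $E(R_1)=\{(u,w):\exists v,\ (u,v,w)\in E(H)\}$, $E(R_2)=\{(u,v):\exists w,\ (u,v,w)\in E(H)\}$. The trivial matching on $U$ is $\{(u,u,u):u\in U\}$. Simplification. Let $S\subseteq U$ and $f\in\{0,1,2\}$. $S$ induces a simplification of $R_f$ if $E(R_f)\cap (S\times(U\setminus S))=\emptyset$ or $E(R_f)\cap((U\setminus S)\times S)=\emptyset$. In that case the simplification of $H$ induced by $S$ via $R_f$ is the 3D graph obtained from $H$ by deleting every edge whose projection to $R_f$ (i.e. the pair obtained by dropping the first, second, or third coordinate for $f=0,1,2$ respectively) lies in $(S\times(U\setminus S))\cup((U\setminus S)\times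 S)$. $H$ simplifies to $H'$ if there is a finite (possibly empty) sequence $H=H_0,H_1,\dots,H_\ell=H'$ and pairs $(S_j,f_j)$ such that $H_j$ is the simplification of $H_{j-1}$ induced by $S_j$ via the projection $R_{f_j}$ of $H_{j-1}$, for each $1\le j\le \ell$ (projections are recomputed at each step). The graph $H_P$. For a puzzle $P\subseteq\{1,2,3\}^k$, $H_P$ is the 3D graph with domain $P$ in which $(u,v,w)\in P^3$ is an edge if and only if there is no $i\in\{1,\dots,k\}$ such that exactly two of the conditions $u_i=1$, $v_i=2$, $w_i=3$ hold. Simplifiable SUSP. A puzzle $P$ is a simplifiable SUSP (strong uniquely solvable puzzle) if $H_P$ simplifies to the 3D graph whose edge set is the trivial matching $\{(u,u,u):u\in P\}$. *)

(* Defs.v *)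
From mathcomp Require Import all_boot.

Set Implicit Arguments.
Unset Strict Implicit.
Unset Printing Implicit Defensive.

(* A row is a word over {1,2,3}; the symbol a is encoded by a - 1 : 'I_3. *)
Notation row k := (k.-tuple 'I_3).

(* The (s,k)-puzzles are the P : puzzle k with #|P| = s. *)
Notation puzzle k := {set row k}.

Definition puzzle_mul (k1 k2 : nat) (P1 : puzzle k1) (P2 : puzzle k2) :
    puzzle (k1 + k2) :=
  [set [tuple of r1 ++ r2] | r1 : row k1 in P1, r2 : row k2 in P2].

(* The recursion starts from the unit of the product, the puzzle whose only
   row is the empty word; it typechecks because m.+1 * k is convertible to
   k + m * k. *)
Fixpoint puzzle_pow (k : nat) (P : puzzle k) (m : nat) : puzzle (m * k) :=
  if m is m'.+1 then puzzle_mul P (puzzle_pow P m') else [set [tuple]].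

(* A 3D graph on the finite domain U is identified with its edge set. *)
Notation graph3 U := {set U * U * U}.

Section Graph3.
Variable U : finType.
Implicit Types (H : graph3 U) (S : {set U}) (f : 'I_3).

Definition drop_coord f (e : U * U * U) : U * U :=
  let: (u, v, w) := e in
  match val f with
  | 0 => (v, w)
  | 1 => (u, w)
  | _ => (u, v)
  end.

Definition projection f H : {set U * U} := [set drop_coord f e | e in H].

Definition induces_simplification S f H : Prop :=
  projection f H :&: setX S (~: S) = set0 \/
  projection f H :&: setX (~: S) S = set0.

Definition simplification S f H : graph3 U :=
  [set e in H | drop_coord f e \notin setX S (~: S) :|: setX (~: S) S].

Inductive simplifies_to : graph3 U -> graph3 U -> Prop :=
| simplifies_refl H : simplifies_to H H
| simplifies_step S f H H' :
    induces_simplification S f H ->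
    simplifies_to (simplification S f H) H' ->
    simplifies_to H H'.

Definition trivial_matching : graph3 U := [set (u, u, u) | u : U].

End Graph3.

(* H_P has domain P itself, as the finite type of its rows. *)
Notation rows_of P := {r | r \in P}.

(* The booleans are summed as naturals to count how many of the three
   conditions u_i = 1, v_i = 2, w_i = 3 hold. *)
Definition puzzle_edge (k : nat) (u v w : row k) : bool :=
  ~~ [exists i : 'I_k,
        ((tnth u i).+1 == 1) + ((tnth v i).+1 == 2) + ((tnth w i).+1 == 3)
          == 2].

Definition puzzle_graph (k : nat) (P : puzzle k) : graph3 (rows_of P) :=
  [set e : rows_of P * rows_of P * rows_of P |
     puzzle_edge (val e.1.1) (val e.1.2) (val e.2)].

Definition simplifiable_SUSP (k : nat) (P : puzzle k) : Prop :=
  simplifies_to (puzzle_graph P) (trivial_matching (rows_of P)).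

(* Main.v *)
Require Import Defs.
From mathcomp Require Import all_boot.

(** Simplifications pull back: if phi : U -> V maps the edges of G into H, then
    the preimage under phi of a set inducing a simplification of H induces one
    of G via the same projection, so if H simplifies to K then G simplifies to
    its edges lying over K. The edges of H_(P1 x P2) are the triples whose two
    factors are edges of H_P1 and of H_P2. Pulling back along the first factor
    and then along the second leaves only the triples that are diagonal in both
    factors, i.e. the trivial matching. *)

Set Implicit Arguments.
Unset Strict Implicit.
Unset Printing Implicit Defensive.

Lemma simplifies_to_trans (U : finType) (G H K : graph3 U) :
  simplifies_to G H -> simplifies_to H K -> simplifies_to G K.
Proof.
elim=> // {}G S f {}H indG _ IH /IH; exact: simplifies_step.
Qed.

Lemma simplifies_to_sub (U : finType) (H K : graph3 U) :
  simplifies_to H K -> K \subset H.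
Proof.
elim=> // {}H S f {}K _ _ /subset_trans; apply.
by apply/subsetP=> e; rewrite inE => /andP[].
Qed.

Section Pullback.
Variables (U V : finType) (phi : U -> V).
Implicit Types (G : graph3 U) (H K : graph3 V) (S : {set V}) (f : 'I_3).

Definition map_triple (e : U * U * U) : V * V * V :=
  (phi e.1.1, phi e.1.2, phi e.2).

Lemma drop_coord_map f e :
  drop_coord f (map_triple e) =
  (phi (drop_coord f e).1, phi (drop_coord f e).2).
Proof. by case: e => -[u v] w; case: f => -[|[|i]] hi. Qed.

Lemma induces_simplification_preim S f G H :
  {in G, forall e, map_triple e \in H} ->
  induces_simplification S f H -> induces_simplification (phi @^-1: S) f G.
Proof.
move=> GH.
(* Arbitrary [A] and [B] cover both directions, from [S] to its complement and back. The projection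
   of an edge of [G] crossing between the preimages would map to a projected edge of [H] crossing
   from [A] to [B]. *)
have sub A B : projection f H :&: setX A B = set0 ->
    projection f G :&: setX (phi @^-1: A) (phi @^-1: B) = set0.
  move=> H0; apply/setP=> d; rewrite !inE.
  apply/negP=> /andP[/imsetP[e eG ->] /andP[hA hB]].
  have /negP[] := negbT (in_set0 (drop_coord f (map_triple e))).
  by rewrite -H0 inE imset_f ?GH // drop_coord_map !inE hA.
by case=> /sub; rewrite preimsetC; [left | right].
Qed.

Lemma simplification_preim S f G H :
  {in G, forall e, map_triple e \in H} ->
  simplification (phi @^-1: S) f G =
  [set e in G | map_triple e \in simplification S f H].
Proof.
move=> GH; apply/setP=> e; rewrite !inE drop_coord_map.
by case eG: (e \in G); rewrite //= GH.
Qed.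

Lemma simplifies_to_preim G H K :
  {in G, forall e, map_triple e \in H} -> simplifies_to H K ->
  simplifies_to G [set e in G | map_triple e \in K].
Proof.
(* [G] is generalized because each step replaces it by its own simplification, which again maps into
   that of [H]. *)
move=> GH HK; elim: HK G GH => {H K} [H|S f H K indH sK IH] G GH.
  rewrite (_ : [set _ in G | _] = G); first exact: simplifies_refl.
  by apply/setP=> e; rewrite inE; case eG: (e \in G) => //=; rewrite GH.
apply: simplifies_step (induces_simplification_preim GH indH) _.
rewrite (simplification_preim _ _ GH).
(* Filtering first by the simplification of [H] changes nothing, since [K] is contained in it. *)
rewrite (_ : [set e in G | map_triple e \in K] =
    [set e in [set e in G | map_triple e \in simplification S f H] |
       map_triple e \in K]).
  by apply: IH => e; rewrite inE => /andP[].
apply/setP=> e; rewrite 2!inE [in RHS]inE -andbA; congr (_ && _).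
by rewrite andb_idl //; apply: subsetP (simplifies_to_sub sK) _.
Qed.

End Pullback.

Lemma mem_trivial_matching (U : finType) (e : U * U * U) :
  (e \in trivial_matching U) = (e.1.1 == e.1.2) && (e.1.2 == e.2).
Proof.
case: e => -[u v] w /=; apply/imsetP/andP => [[x _ [-> -> ->]]|] //.
by case=> /eqP-> /eqP->; exists w.
Qed.

(** A symbol equals exactly one of 1, 2, 3, so the count at each coordinate is 1, never 2. *)
Lemma puzzle_edge_diag k (u : row k) : puzzle_edge u u u.
Proof.
by apply/existsP=> -[i]; case: (tnth u i) => -[|[|[|]]].
Qed.

Lemma puzzle_edge_cat k1 k2 (u1 v1 w1 : row k1) (u2 v2 w2 : row k2) :
  puzzle_edge [tuple of u1 ++ u2] [tuple of v1 ++ v2] [tuple of w1 ++ w2] =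
  puzzle_edge u1 v1 w1 && puzzle_edge u2 v2 w2.
Proof.
rewrite -negb_or; congr (~~ _); apply/existsP/orP.
  case=> i; rewrite -(splitK i); case: (split i) => j /=;
    rewrite ?tnth_lshift ?tnth_rshift => hj;
    by [left; apply/existsP; exists j | right; apply/existsP; exists j].
case=> /existsP[j hj].
  by exists (lshift k2 j); rewrite !tnth_lshift.
by exists (rshift k1 j); rewrite !tnth_rshift.
Qed.

Lemma simplifiable_SUSP_mul k1 k2 (P1 : puzzle k1) (P2 : puzzle k2) :
  simplifiable_SUSP P1 -> simplifiable_SUSP P2 ->
  simplifiable_SUSP (puzzle_mul P1 P2).
Proof.
rewrite /simplifiable_SUSP => sP1 sP2.
(* Finite choice turns the existence of a splitting for each row into a function [phi]; its
   components are the two maps to pull back along. *)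
have /fin_all_exists[phi phiE] (r : rows_of (puzzle_mul P1 P2)) :
    exists p : rows_of P1 * rows_of P2,
      val r = [tuple of val p.1 ++ val p.2].
  have /imset2P[r1 r2 r1P r2P rE] := valP r.
  by exists (Sub r1 r1P, Sub r2 r2P).
pose G := puzzle_graph (puzzle_mul P1 P2).
have GE e : (e \in G) =
    (map_triple (fst \o phi) e \in puzzle_graph P1) &&
    (map_triple (snd \o phi) e \in puzzle_graph P2).
  by rewrite !inE !phiE puzzle_edge_cat.
have G1 : {in G, forall e, map_triple (fst \o phi) e \in puzzle_graph P1}.
  by move=> e; rewrite GE => /andP[].
apply: simplifies_to_trans (simplifies_to_preim G1 sP1) _.
set G' := [set e in G | _].
have G2 : {in G', forall e, map_triple (snd \o phi) e \in puzzle_graph P2}.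
  by move=> e; rewrite inE GE => /andP[/andP[]].
have := simplifies_to_preim G2 sP2.
rewrite (_ : [set e in G' | _] = trivial_matching _) //.
(* A row is recovered by concatenating its two parts, so a triple diagonal in both factors is
   diagonal. *)
have phi_inj : injective phi.
  by move=> r s rs; apply: val_inj; rewrite !phiE rs.
apply/setP=> -[[u v] w]; rewrite 3!inE !mem_trivial_matching /=.
have eq_phi r s :
    (r == s) = ((phi r).1 == (phi s).1) && ((phi r).2 == (phi s).2).
  by rewrite -(inj_eq phi_inj) -pair_eqE.
apply/andP/andP=> [[/and3P[_ a b] /andP[c d]]|[/eqP-> /eqP->]].
  by rewrite !eq_phi a b c d.
by rewrite puzzle_edge_diag !eqxx.
Qed.

(** The empty word is the only row, so the graph is already the trivial matching. This starts the
    induction along [puzzle_pow]. *)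
Lemma simplifiable_SUSP_unit : simplifiable_SUSP [set [tuple] : row 0].
Proof.
rewrite /simplifiable_SUSP.
rewrite (_ : puzzle_graph _ = trivial_matching _); first exact: simplifies_refl.
have unitE (r s : rows_of [set [tuple] : row 0]) : r = s.
  by apply: val_inj; rewrite (tuple0 (val r)) (tuple0 (val s)).
apply/setP=> -[[u v] w]; rewrite mem_trivial_matching inE /=.
by rewrite (unitE u w) (unitE v w) puzzle_edge_diag !eqxx.
Qed.

Theorem corollary5 (k : nat) (P : puzzle k) (hP : simplifiable_SUSP P)
    (m : nat) (hm : 1 <= m) : simplifiable_SUSP (puzzle_pow P m).
Proof.
elim: m {hm} => [|m IHm]; first exact: simplifiable_SUSP_unit.
exact: simplifiable_SUSP_mul hP IHm.
Qed.
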